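(* Let $G$ be a graph with convex balls. Then any BFS order of the vertices of $G$ is a dismantling order of the square $G^2$.
   Context: Graphs are simple, undirected, connected (possibly infinite), with all cliques finite. $d$ is the graph distance; $G$ has convex balls if every ball $B_r(v)$ contains every vertex on a shortest path between two of its vertices. $G^2$ has the same vertices as $G$, with $u,v$ adjacent iff $1\le d_G(u,v)\le 2$. $N(x)$ is the set of neighbors of $x$. BFS order (Polat): a well-order $\preceq$ on $V(G)$ for which there is a family $\{A_x:x\in V(G)\}$ of vertex subsets such that for every $x$: (S1) $x\in A_x$; (S2) if $x\preceq y$ then $(A_x,\preceq)$ is an initial segment of $(A_y,\preceq)$; (S3) $A_x=A_{(x)}\cup N(x)$, where $A_{(x)}=\{x\}$ if $x$ is the least element and $A_{(x)}=\bigcup_{y\prec x}A_y$ otherwise. A vertex $x$ is dominated by a vertex $y$ in a graph $H$ if $B_1(x)\subseteq B_1(y)$ in $H$. A well-order $\prec$ of $V(H)$ is a dismantling order of $H$ if every vertex $v$ other than the least element has a neighbor $w\prec v$ in $H$ which dominates $v$ in the subgraph of $H$ induced by $\{u:u\preceq v\}$. *)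

(* Defs.v *)
From mathcomp Require Import all_boot all_classical.
From mathcomp Require Export wochoice.

Set Implicit Arguments.
Unset Strict Implicit.
Unset Printing Implicit Defensive.

Local Open Scope classical_set_scope.

(* A graph is given by its vertex type V (possibly infinite) and its adjacency
   relation e : rel V; assumptions on e are separate hypotheses. *)

Section Graph.
Variables (V : eqType) (e : rel V).
Implicit Types (u v w x y : V) (S : set V).

Definition has_walk x y (n : nat) : Prop :=
  exists2 p : seq V, path e x p & last x p = y /\ size p = n.

Definition reachable x y : Prop := exists n, has_walk x y n.

Definition connected_graph : Prop := forall x y, reachable x y.

(* The distance is the least length of a walk, with the junk value 0 if there
   is none; [ball] therefore also requires reachability (induced subgraphs need
   not be connected). *)
Definition dist x y : nat :=
  if pselect (exists n, `[< has_walk x y n >]) is left h then ex_minn h else 0.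

Definition ball (r : nat) v : set V :=
  [set u | reachable v u /\ dist v u <= r].

Definition neighbors x : set V := [set y | e x y].

Definition clique S : Prop := forall x y, S x -> S y -> x != y -> e x y.

Definition finite_cliques : Prop := forall S, clique S -> finite_set S.

Definition shortest_path u v (p : seq V) : Prop :=
  [/\ path e u p, last u p = v & size p = dist u v].

Definition convex_set S : Prop :=
  forall u v, S u -> S v ->
  forall p, shortest_path u v p -> forall w, w \in u :: p -> S w.

Definition convex_balls : Prop := forall r v, convex_set (ball r v).

(* Unreachable pairs have junk distance 0, so they are not adjacent here. *)
Definition square : rel V := [rel u v | 1 <= dist u v <= 2].

Definition dominated x y : Prop := ball 1 x `<=` ball 1 y.

End Graph.

Definition induced (V : eqType) (e : rel V) (S : set V) : rel S :=
  [rel a b | e (val a) (val b)].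

Section Orders.
(* In R x y, the relation R is the reflexive order "x precedes y"; well_order
   from wochoice (every nonempty subset has a unique minimum) makes R a total
   order. *)
Variables (V : eqType) (R : rel V).
Implicit Types (x y v w : V) (A B : set V).

Definition strict : rel V := [rel x y | R x y && (x != y)].

Definition least x : Prop := forall y, R x y.

Definition initial_segment A B : Prop :=
  A `<=` B /\ forall x y, A x -> B y -> R y x -> A y.

Definition before (A : V -> set V) x : set V :=
  if `[< least x >] then [set x] else \bigcup_(y in [set y | strict y x]) A y.

Definition BFS_family (e : rel V) (A : V -> set V) : Prop :=
  [/\ forall x, A x x,
      forall x y, R x y -> initial_segment (A x) (A y)
    & forall x, A x = before A x `|` neighbors e x].

Definition BFS_order (e : rel V) : Prop :=
  well_order R /\ exists A : V -> set V, BFS_family e A.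

Definition dominated_in (h : rel V) (S : set V) x y : Prop :=
  exists a b : S, [/\ val a = x, val b = y & dominated (induced h (S := S)) a b].

Definition dismantling_order (h : rel V) : Prop :=
  well_order R /\
  forall v, ~ least v ->
    exists w, [/\ h v w, strict w v & dominated_in h [set u | R u v] v w].

End Orders.

(* Main.v *)
(** Let [b] be the least vertex and [f v] the least neighbor of [v] (with [f b
= b]); in a BFS order [f] is monotone and lowers the distance to [b] by one.
The father [f v] dominates [v] in the square.  The key step concerns an edge
[uv] inside a sphere around [b], with [u] before [v]: either [u] is adjacent
to [f v], or [f (f u) = f (f v)].  For [u] before [v] at distance 2 on the
same sphere, with common neighbor [m] on that sphere, applying this to [um]
and [mv] shows that [f v] or [f (f v)] is within distance 2 of [u]; in the
latter case [f v] lies between two vertices of the ball of radius 2 around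
[u], so convexity gives [d u (f v) <= 2]. *)

Require Import Defs.
From mathcomp Require Import all_boot all_classical.
From mathcomp Require Import zify.

Set Implicit Arguments.
Unset Strict Implicit.
Unset Printing Implicit Defensive.

Local Open Scope classical_set_scope.

(** * Walks and distance in an arbitrary graph *)

Section Distance.
Variables (V : eqType) (e : rel V).
Implicit Types (u v w x y z : V).

Lemma has_walk0 x y : has_walk e x y 0 <-> x = y.
Proof.
split=> [[p _ [<- /size0nil->]] //|->]; by exists [::].
Qed.

Lemma has_walkS x y n :
  has_walk e x y n.+1 <-> exists2 z, e x z & has_walk e z y n.
Proof.
split=> [[[|z p] /=]|[z xz [p pz [pl ps]]]]; first by move=> _ [].
  by case/andP=> xz pz [pl [ps]]; exists z => //; exists p.
by exists (z :: p); rewrite /= ?xz // ps.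
Qed.

Lemma has_walk1 x y : has_walk e x y 1 <-> e x y.
Proof.
rewrite has_walkS; split=> [[z xz /has_walk0 <-] //|xy].
by exists y => //; apply/has_walk0.
Qed.

Lemma has_walk_cat x y z m n :
  has_walk e x y m -> has_walk e y z n -> has_walk e x z (m + n).
Proof.
move=> [p px [<- <-]] [q qy [<- <-]]; exists (p ++ q).
  by rewrite cat_path px.
by rewrite last_cat size_cat.
Qed.

Lemma dist_min x y n : has_walk e x y n -> dist e x y <= n.
Proof.
move=> xyn; rewrite /dist; case: pselect => // h.
by case: ex_minnP => m _; apply; apply/asboolP.
Qed.

Lemma dist_walk x y : reachable e x y -> has_walk e x y (dist e x y).
Proof.
move=> [n xyn]; rewrite /dist; case: pselect => [h|[]]; last first.
  by exists n; apply/asboolP.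
by case: ex_minnP => m /asboolP.
Qed.

Lemma distxx x : dist e x x = 0.
Proof. by apply/eqP; rewrite -leqn0; apply/dist_min/has_walk0. Qed.

(** Free of connectedness, so that it applies to induced subgraphs of the square. *)
Lemma ball1E x y : ball e 1 x y <-> x = y \/ e x y.
Proof.
split=> [[/dist_walk]|[->|xy]].
- case: dist => [/has_walk0|[/has_walk1|]] //; by [left|right].
- split; last by rewrite distxx.
  by exists 0; apply/has_walk0.
- split; first by exists 1; apply/has_walk1.
  exact/dist_min/has_walk1.
Qed.

End Distance.

(** * The metric of a connected graph *)

Section ConnectedDistance.
Variables (V : eqType) (e : rel V).
Hypotheses (e_sym : symmetric e) (e_conn : connected_graph e).
Implicit Types (u v w x y z : V) (r n : nat).
Local Notation d := (dist e).

Lemma dist_eq0 x y : d x y = 0 -> x = y.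
Proof.
by move=> d0; have := dist_walk (e_conn x y); rewrite d0 => /has_walk0.
Qed.

Lemma dist_adj x y : e x y -> d x y <= 1.
Proof. by move=> xy; apply/dist_min/has_walk1. Qed.

Lemma dist_le1 x y : d x y <= 1 -> x = y \/ e x y.
Proof. by move=> xy; apply/ball1E. Qed.

Lemma dist_triangle y x z : d x z <= d x y + d y z.
Proof. exact/dist_min/(has_walk_cat (dist_walk _) (dist_walk _)). Qed.

Lemma dist_sym x y : d x y = d y x.
Proof.
suff le u v : d u v <= d v u by apply/eqP; rewrite eqn_leq !le.
have [p pp [pl <-]] := dist_walk (e_conn v u).
apply: dist_min; exists (rev (belast v p)); last first.
  rewrite size_rev size_belast; split=> //.
  by case: p {pp} pl => //= z p _; rewrite rev_cons last_rcons.
rewrite -pl rev_path (eq_path (e' := e)) //.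
Qed.

Lemma dist_next x y n : d x y = n.+1 -> exists2 z, e x z & d z y = n.
Proof.
move=> xyn; have /= := dist_walk (e_conn x y); rewrite xyn.
case/has_walkS=> z xz /dist_min zy; exists z => //.
have := dist_triangle z x y; have := dist_adj xz; lia.
Qed.

Lemma dist_two x y z : e x y -> e y z -> d x z <= 2.
Proof.
move=> xy yz; have := dist_triangle y x z.
have := dist_adj xy; have := dist_adj yz; lia.
Qed.

Lemma dist2_mid x y : d x y = 2 -> exists2 z, e x z & e z y.
Proof.
case/dist_next=> z xz zy1; exists z => //.
have [zy|//] := dist_le1 (eq_leq zy1).
by move: zy1; rewrite zy distxx.
Qed.

End ConnectedDistance.

(** * Local consequences of convex balls *)

Section ConvexBalls.
Variables (V : eqType) (e : rel V).
Hypotheses (e_sym : symmetric e) (e_conn : connected_graph e).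
Hypothesis e_convex : convex_balls e.
Implicit Types (u v w x y z : V) (r n : nat).
Local Notation d := (dist e).
Local Notation tri := (dist_triangle e_conn).
Local Notation ds := (dist_sym e_sym e_conn).
Local Notation dist2 := (dist_two e_conn).

(** The walk [x], [w], [y] is a shortest path, since its ends are more than 1 apart. *)
Lemma convex_ball2 w v r x y :
  e x w -> e w y -> 1 < d x y -> d v x <= r -> d v y <= r -> d v w <= r.
Proof.
move=> xw wy xy vx vy; have xy2 : d x y = 2.
  by have := tri w x y; have := dist_adj xw; have := dist_adj wy; lia.
have [] // := @e_convex r v x y _ _ [:: w; y] _ w; rewrite ?inE ?eqxx ?orbT //.
by split=> //=; rewrite xw wy.
Qed.

Lemma convex_ball3 w1 w2 v r x y :
  e x w1 -> e w1 w2 -> e w2 y -> 2 < d x y -> d v x <= r -> d v y <= r ->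
  d v w1 <= r /\ d v w2 <= r.
Proof.
move=> xw ww wy xy vx vy; have xy3 : d x y = 3.
  have := tri w1 x y; have := tri w2 w1 y.
  by have := dist_adj xw; have := dist_adj ww; have := dist_adj wy; lia.
have h w : w \in [:: x; w1; w2; y] -> d v w <= r.
  move=> hw; have [] // := @e_convex r v x y _ _ [:: w1; w2; y] _ w.
  by split=> //=; rewrite xw ww wy.
by split; apply: h; rewrite !inE eqxx ?orbT.
Qed.

(** Otherwise [x] lies between two vertices of the ball of radius [(d v x).-1] around [v]. *)
Lemma interval_clique v x y z :
  e x y -> e x z -> d v y < d v x -> d v z < d v x -> d y z <= 1.
Proof.
move=> xy xz vy vz; rewrite leqNgt; apply/negP => yz.
have := convex_ball2 (w := x) (v := v) (r := (d v x).-1) (x := y) (y := z).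
by rewrite e_sym => /(_ xy xz yz); lia.
Qed.

Lemma square_chord x y z w :
  e x y -> e y z -> e z w -> e w x -> d x z <= 1 \/ d y w <= 1.
Proof.
move=> xy yz zw wx; case: (leqP (d x z) 1) => xz; [by left|right].
(* The unit ball around [w] contains [x] and [z], hence [y]. *)
rewrite ds; apply: (convex_ball2 xy yz xz); last by rewrite ds; apply: dist_adj.
exact: dist_adj.
Qed.

(** * Levels and fathers *)

Section Father.
Variables (R : rel V) (b : V) (f : V -> V).
Hypotheses (R_anti : antisymmetric R) (R_trans : transitive R).
Hypothesis R_total : total R.
Hypothesis R_least : least R b.
Hypotheses (f_root : f b = b) (f_adj : forall v, v <> b -> e v (f v)).
Hypothesis f_min : forall v y, e v y -> R (f v) y.
Hypothesis f_mono : {homo f : u v / R u v}.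
Hypothesis e_irr : irreflexive e.
Local Notation lower_clique := (@interval_clique b).

Lemma anti x y : R x y -> R y x -> x = y.
Proof. by move=> xy yx; apply: R_anti; rewrite xy. Qed.

(* Boolean adjacency atoms in the context make [lia] blow up. *)
Ltac nat_lia :=
  repeat match goal with
  | H : is_true (e _ _) |- _ => clear H
  | H : is_true (R _ _) |- _ => clear H
  | H : ~ _ |- _ => clear H
  | H : @eq V _ _ |- _ => clear H
  | H : forall _, _ |- _ => clear H
  end; lia.

(** Induction on the level of [v]: a neighbor [y] of [v] one level down comes no earlier than [f v],
    which comes no earlier than [f u]. *)
Lemma level_mono u v : R u v -> d b u <= d b v.
Proof.
have [n] := ubnP (d b v); elim: n u v => // n IH u v vn uv.
case: (eqVneq u b) => [->|/eqP ub]; first by rewrite distxx.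
case: (eqVneq v b) => [vb|/eqP vb].
  by case: ub; apply: anti (R_least u); rewrite -vb.
case dv: (d b v) => [|k]; first by case: vb; rewrite (dist_eq0 e_conn dv).
have [y vy yb] := dist_next e_conn (etrans (ds v b) dv).
have fv : d b (f v) <= d b y by apply: IH (f_min vy); rewrite ds; nat_lia.
have fu : d b (f u) <= d b (f v).
  by apply: IH (f_mono uv); move: fv; rewrite (ds b y); nat_lia.
have := tri (f u) b u; have := dist_adj (f_adj ub); rewrite (ds u).
by move: fv; rewrite (ds b y); nat_lia.
Qed.

Lemma level_father v : d b (f v) = (d b v).-1.
Proof.
case: (eqVneq v b) => [->|/eqP vb]; first by rewrite f_root distxx.
case dv: (d b v) => [|k]; first by case: vb; rewrite (dist_eq0 e_conn dv).
have [y vy yb] := dist_next e_conn (etrans (ds v b) dv).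
have := level_mono (f_min vy).
have := tri (f v) b v; have := dist_adj (f_adj vb); rewrite (ds v) (ds b y) yb.
nat_lia.
Qed.

Lemma level0 v : d b v = 0 -> v = b.
Proof. by move/(dist_eq0 e_conn). Qed.

Lemma level_adj v : 0 < d b v -> e v (f v).
Proof. by move=> v0; apply: f_adj => vb; move: v0; rewrite vb distxx. Qed.

Lemma level_step x y : e x y -> d b x <= (d b y).+1 /\ d b y <= (d b x).+1.
Proof.
move=> xy; have := tri x b y; have := tri y b x.
have := dist_adj xy; rewrite (ds y x); nat_lia.
Qed.

(** A common neighbor [z] of [v] and [y] exists, and [f (f v)], [f z], [y] are in weakly increasing
    order. *)
Lemma grandfather_min v y :
  d b y + 2 <= d b v -> d v y <= 2 -> R (f (f v)) y.
Proof.
move=> yv vy; have := tri y b v; rewrite (ds y v) => vy2.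
have /(dist2_mid e_conn)[z vz zy] : d v y = 2 by nat_lia.
apply: R_trans (f_mono (f_min vz)) (f_min zy).
Qed.

Lemma edge_fathers u v :
  d b u = d b v -> e u v -> R u v -> e u (f v) \/ f (f u) = f (f v).
Proof.
move vn: (d b v) => n; elim: n u v vn => [|n IH] u v vn un uv Ruv.
  have vb : v = b by apply: level0.
  have ub : u = b by apply: level0; rewrite un.
  by move: uv; rewrite vb ub e_irr.
have lc := level_father v; have la := level_father u.
have lq := level_father (f v); have lq' := level_father (f u).
(* Up to level 2 both grandfathers are [b]. *)
case: (leqP n 1) => [n1|n2].
  by right; rewrite (@level0 (f (f u))) 1?(@level0 (f (f v))) //; nat_lia.
have lr := level_father (f (f v)); have lr' := level_father (f (f u)).
case: (boolP (e u (f v))) => [uc|nuc]; [by left|right].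
case: (eqVneq (f (f u)) (f (f v))) => // /eqP qq; exfalso.
have ua : e u (f u) by apply: level_adj; nat_lia.
have vc : e v (f v) by apply: level_adj; nat_lia.
have aq : e (f u) (f (f u)) by apply: level_adj; nat_lia.
have cq : e (f v) (f (f v)) by apply: level_adj; nat_lia.
have qr : e (f (f v)) (f (f (f v))) by apply: level_adj; nat_lia.
have qr' : e (f (f u)) (f (f (f u))) by apply: level_adj; nat_lia.
have vu : e v u by rewrite e_sym.
have Rac : R (f u) (f v) by apply: f_mono.
have Rqq : R (f (f u)) (f (f v)) by apply: f_mono.
have vq' : 2 < d v (f (f u)).
  rewrite ltnNge; apply/negP => vq; apply: qq; apply: anti => //.
  by apply: grandfather_min vq; nat_lia.
have uc : 1 < d u (f v).
  rewrite ltnNge; apply/negP => /dist_le1-/(_ e_conn)[uc|]; last exact/negP.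
  by move: un; rewrite uc; nat_lia.
(* Convexity around [f (f u)]: [v] lies between [u] and [f v]. *)
have cq' : 2 < d (f v) (f (f u)).
  rewrite ltnNge; apply/negP => cq2; move: vq'; rewrite ltnNge => /negP; apply.
  rewrite ds; apply: (convex_ball2 uv vc uc); rewrite ds //.
  exact: dist2 ua aq.
have av : 1 < d (f u) v.
  rewrite ltnNge; apply/negP => /dist_le1-/(_ e_conn)[av|av].
    by move: la; rewrite av; nat_lia.
  have ca : R (f v) (f u) by apply: f_min; rewrite e_sym.
  by apply: qq; rewrite (anti Rac ca).
(* Adjacent fathers would close a 4-cycle with [u] and [v], both of whose chords are excluded. *)
have ac1 : 1 < d (f u) (f v).
  rewrite ltnNge; apply/negP => /dist_le1-/(_ e_conn)[ac|ac].
    by apply: qq; rewrite ac.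
  have cv : e (f v) v by rewrite e_sym.
  by have := square_chord ua ac cv vu; nat_lia.
(* At distance 3, [u] and [v] would lie between their fathers, hence in the ball of radius [n]
   around [b]. *)
have ac : d (f u) (f v) = 2.
  apply/eqP; rewrite eqn_leq ac1 andbT leqNgt; apply/negP => ac.
  have au : e (f u) u by rewrite e_sym.
  by have := convex_ball3 (v := b) (r := n) au uv vc ac; nat_lia.
have lu : d b (f u) = n by nat_lia.
have lv : d b (f v) = n by nat_lia.
(* Convexity around [f v] along [f u], [f (f u)], [s] would contradict [cq']. *)
have key1 s : f (f (f u)) = s -> d (f v) s <= 2 -> False.
  move=> <- cr; move: cq'; rewrite ltnNge => /negP; apply.
  apply: (convex_ball2 aq qr') => //; last by rewrite ds ac.
  by have := tri (f (f (f u))) b (f u); rewrite (ds (f (f (f u)))); nat_lia.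
(* The mirror image; its conclusion becomes contradictory only once [aq2] is known. *)
have key2 s : f (f (f v)) = s -> d (f u) s <= 2 -> d (f u) (f (f v)) <= 2.
  move=> <- cr; apply: (convex_ball2 cq qr) => //; last by rewrite ac.
  by have := tri (f (f (f v))) b (f v); rewrite (ds (f (f (f v)))); nat_lia.
(* If [f (f v)] is within distance 2 of [u], then minimality of the fathers
   forces [f z = f (f v)] for a common neighbor [z]; apply the induction
   hypothesis to the edge from [f u] to [z]. *)
case: (leqP (d u (f (f v))) 2) => [uq|uq].
  have [z uz zq] : exists2 z, e u z & e z (f (f v)).
    apply: (dist2_mid e_conn); have := tri (f (f v)) b u.
    by rewrite (ds (f (f v))); nat_lia.
  have lz : d b z = n by have := level_step uz; have := level_step zq; nat_lia.
  have ls := level_father z; have zs : e z (f z) by apply: level_adj; nat_lia.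
  have sq : d (f z) (f (f v)) <= 1 by apply: lower_clique zs zq _ _; nat_lia.
  (* Convexity around [f z], which is within distance 2 of both [u] and [f v]. *)
  have vs : d (f z) v <= 2.
    apply: (convex_ball2 uv vc uc); last first.
      have := tri (f (f v)) (f z) (f v); have := dist_adj cq.
      by rewrite (ds (f (f v)) (f v)); nat_lia.
    by rewrite ds; apply: dist2 uz zs.
  have sq' : f z = f (f v).
    apply: anti; first exact: f_min.
    by apply: grandfather_min; rewrite ds in vs; nat_lia.
  have [az|az] : f u = z \/ e (f u) z.
    by apply: dist_le1 => //; apply: lower_clique ua uz _ _; nat_lia.
    by apply: qq; rewrite az.
  have [aq2|rr] := IH _ _ lz lu az (f_min uz).
    rewrite sq' in aq2; have := lower_clique aq2 aq _ _.
    by have := tri (f (f v)) (f v) (f (f u)); have := dist_adj cq; nat_lia.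
  apply: key1 rr _; rewrite sq'; exact: dist2 cq qr.
(* Convexity around [f (f v)]: [u] lies between [f u] and [v]. *)
have aq2 : 2 < d (f u) (f (f v)).
  rewrite ltnNge; apply/negP => aq2; move: uq; rewrite ltnNge => /negP; apply.
  have au : e (f u) u by rewrite e_sym.
  rewrite ds; apply: (convex_ball2 au uv av); rewrite ds //.
  exact: dist2 vc cq.
(* Otherwise a common neighbor [t] of [f u] and [f v] lies on their sphere, and
   the induction hypothesis applies to both edges at [t]. *)
have [t at_ tc] := dist2_mid e_conn ac.
have lt_n : d b t <= n by apply: (convex_ball2 at_ tc ac1); nat_lia.
have lt : d b t = n.
  apply/eqP; rewrite eqn_leq lt_n leqNgt; apply/negP => tn.
  have := lower_clique at_ aq _ _; have := tri t (f v) (f (f u)).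
  have := dist_adj tc.
  by rewrite (ds t (f v)); nat_lia.
have ls := level_father t; have ts : e t (f t) by apply: level_adj; nat_lia.
have sr : e (f t) (f (f t)) by apply: level_adj; nat_lia.
have ta : e t (f u) by rewrite e_sym.
have ct : e (f v) t by rewrite e_sym.
have far_c : ~ e t (f (f u)).
  move=> tq; have := dist2 ct tq; nat_lia.
have far_a : ~ e t (f (f v)).
  move=> tq; have := dist2 at_ tq; nat_lia.
(* Either orientation of the edge gives a walk of length 2 through [f t] or [f (f v)]. *)
have cs : d (f v) (f (f t)) <= 2.
  case/orP: (R_total (f v) t) => Rct.
    have [cs|<-] := IH _ _ lt lv ct Rct; first exact: dist2 cs sr.
    exact: dist2 cq qr.
  have [//|->] := IH _ _ lv lt tc Rct.
  exact: dist2 cq qr.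
have as_ : d (f u) (f (f t)) <= 2.
  case/orP: (R_total (f u) t) => Rat.
    have [cs'|<-] := IH _ _ lt lu at_ Rat; first exact: dist2 cs' sr.
    exact: dist2 aq qr'.
  have [//|->] := IH _ _ lu lt ta Rat.
  exact: dist2 aq qr'.
have nr' : f (f (f u)) <> f (f t) by move/key1; apply.
have nr : f (f (f v)) <> f (f t) by move/key2 => /(_ as_); nat_lia.
have Rct : R (f v) t.
  case/orP: (R_total (f v) t) => // Rct.
  by have [/far_a|/esym/nr] := IH _ _ lv lt tc Rct.
have Rat : R (f u) t.
  case/orP: (R_total (f u) t) => // Rat.
  by have [/far_c|/esym/nr'] := IH _ _ lu lt ta Rat.
(* Now [f t] is adjacent to [f u] and [f v]; being a lower neighbor of [f u], it is within 1 of
   [f (f u)], against [cq']. *)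
have [es|/nr'//] := IH _ _ lt lu at_ Rat.
have [cs'|/nr//] := IH _ _ lt lv ct Rct.
have := lower_clique aq es _ _; have := tri (f t) (f v) (f (f u)).
have := dist_adj cs'; rewrite (ds (f (f u))); nat_lia.
Qed.

Lemma father_dominates u v :
  v <> b -> R u v -> d u v <= 2 -> d u (f v) <= 2.
Proof.
move=> vb Ruv uv2; have vc := f_adj vb.
have luv := level_mono Ruv; have lc := level_father v.
have v0 : 0 < d b v by rewrite lt0n; apply/eqP => /level0.
case: (ltnP 1 (d b v)) => [v2|v1]; last first.
  have -> : f v = b by apply: level0; nat_lia.
  rewrite ds; nat_lia.
case: (leqP (d u v) 1) => [uv1|uv1].
  have := tri v u (f v); have := dist_adj vc; nat_lia.
have uv : d u v = 2 by nat_lia.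
have [m um mv] := dist2_mid e_conn uv.
have lm : d b m <= d b v by apply: (convex_ball2 um mv).
rewrite leqNgt; apply/negP => uc.
(* Were [u] lower, convexity along [u], [m], [v], [f v] would put [v] below its own level. *)
have lu : d b u = d b v.
  by have := convex_ball3 (v := b) (r := (d b v).-1) um mv vc uc; nat_lia.
have lmv : d b m = d b v.
  have [mv1|] := ltnP (d b m) (d b v); last by nat_lia.
  have vm : e v m by rewrite e_sym.
  have := lower_clique vc vm _ mv1; have := tri m u (f v); have := dist_adj um.
  by rewrite (ds m (f v)); nat_lia.
have lum : d b u = d b m by nat_lia.
have la := level_father u; have lp := level_father m.
have lq := level_father (f v).
have cq : e (f v) (f (f v)) by apply: level_adj; nat_lia.
have ua : e u (f u) by apply: level_adj; nat_lia.
have pq : e (f m) (f (f m)) by apply: level_adj; nat_lia.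
have aq : e (f u) (f (f u)) by apply: level_adj; nat_lia.
(* Convexity around [u]: [f v] lies between [v] and [f (f v)]. *)
have far_q : 2 < d u (f (f v)).
  rewrite ltnNge; apply/negP => uq; move: uc; rewrite ltnNge => /negP; apply.
  apply: (convex_ball2 vc cq) => //.
  have := tri (f (f v)) b v; rewrite (ds (f (f v))); nat_lia.
have mu : e m u by rewrite e_sym.
have vm : e v m by rewrite e_sym.
have Raq : R (f (f u)) (f (f v)) by apply/f_mono/f_mono.
have far_u : f (f u) <> f (f v).
  by move=> uvq; have := dist2 ua aq; rewrite uvq; nat_lia.
(* For each position of [m] in the order, [edge_fathers] on [um] and [mv] contradicts [uc], [far_q]
   or [far_u]. *)
case/orP: (R_total m v) => Rmv.
  have [mc|mvq] := edge_fathers lmv mv Rmv.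
    by have := dist2 um mc; nat_lia.
  case/orP: (R_total u m) => Rum.
    have [up|umq] := edge_fathers lum um Rum.
      by have := dist2 up pq; rewrite mvq; nat_lia.
    by apply: far_u; rewrite umq.
  have [ma|umq] := edge_fathers (esym lum) mu Rum.
    apply: far_u; apply: anti => //; rewrite -mvq; exact/f_mono/f_min.
  by apply: far_u; rewrite -umq.
have Rum : R u m by apply: R_trans Ruv Rmv.
have [up|umq] := edge_fathers lum um Rum.
  have [vp|vmq] := edge_fathers (esym lmv) vm Rmv.
    have := lower_clique vc vp _ _; have := tri (f m) u (f v).
    have := dist_adj up; rewrite (ds (f v) (f m)); nat_lia.
  by have := dist2 up pq; rewrite -vmq; nat_lia.
by apply: far_u; apply: anti => //; rewrite umq; exact/f_mono/f_mono.
Qed.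

End Father.
End ConvexBalls.

(** * Order axioms from the well-order property *)

Section WellOrder.
Variables (V : eqType) (R : rel V).
Hypothesis R_wo : well_order R.

Let R_chain : wo_chain R predT := withinW R_wo.

Lemma well_order_min (A : set V) (x : V) :
  A x -> exists2 z, A z & forall y, A y -> R z y.
Proof.
move=> Ax.
have [|z [[/asboolP Az zmin] _]] := R_wo (A := [pred y | `[< A y >]]).
  by exists x; apply/asboolP.
by exists z => // y Ay; apply: zmin; apply/asboolP.
Qed.

Lemma well_order_anti : antisymmetric R.
Proof. by move=> x y; apply: wo_chain_antisymmetric R_chain _ _ _ _. Qed.

Lemma well_order_total : total R.
Proof. by move=> x y; apply: wo_chainW R_chain _ _ _ _. Qed.

Lemma well_order_refl : reflexive R.
Proof. by move=> x; have := well_order_total x x; rewrite orbb. Qed.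

(** The minimum of [x], [y], [z] is [x], unless antisymmetry identifies two consecutive ones. *)
Lemma well_order_trans : transitive R.
Proof.
move=> y x z xy yz.
have [|w /= wP wmin] := @well_order_min [set u | u \in [:: x; y; z]] y.
  by rewrite /= !inE eqxx orbT.
have min u : u \in [:: x; y; z] -> R w u by exact: wmin.
have anti u v : R u v -> R v u -> u = v.
  by move=> uv vu; apply: well_order_anti; rewrite uv.
have [wx wy wz] : [/\ R w x, R w y & R w z].
  by split; apply: min; rewrite !inE eqxx ?orbT.
move: wP; rewrite /= !inE => /or3P[]/eqP Ew; first by rewrite -Ew.
  by rewrite (anti x y) // -Ew.
by have <- : y = z by apply: anti => //; rewrite -Ew.
Qed.

End WellOrder.

(** * The father map of a BFS order *)

Lemma BFS_father (V : eqType) (R e : rel V) (b : V) :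
  symmetric e -> irreflexive e -> BFS_order R e -> least R b ->
  exists f : V -> V,
    [/\ f b = b, forall v, v <> b -> e v (f v) /\ strict R (f v) v,
        forall v y, e v y -> R (f v) y & {homo f : u v / R u v}].
Proof.
move=> e_sym e_irr [R_wo [A [A_refl A_init A_eq]]] b_least.
have anti x y : R x y -> R y x -> x = y.
  by move=> xy yx; apply: (well_order_anti R_wo); rewrite xy.
(* [f v] is the least index whose set contains [v]. *)
have /choice[f fP] v : exists z, A z v /\ forall y, A y v -> R z y.
  have [z zv zmin] := @well_order_min _ _ R_wo [set z | A z v] v (A_refl v).
  by exists z.
have A_nbr x y : e x y -> A x y by rewrite A_eq; right.
exists f; split=> [|v vb|v y vy|u v uv].
- by apply: anti => //; apply: (fP b).2.
- have no_least x : x <> b -> ~ least R x.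
    by move=> xb xl; apply: xb; apply: anti.
  have [fv fmin] := fP v.
  have earlier x : x <> b -> before R A x v -> exists2 y, strict R y x & A y v.
    rewrite /before => xb; case: asboolP => [/(no_least x xb)//|_ [y yx yv]].
    by exists y.
  have fv_lt : strict R (f v) v.
    have := A_refl v; rewrite A_eq.
    case=> [/(earlier v vb)[y /andP[yv yNv] /fmin fy]|].
      rewrite /strict /= (well_order_trans R_wo fy yv) /=.
      apply: contraNneq yNv => Efv; apply/eqP/anti => //; by rewrite -Efv.
    by rewrite /neighbors /= e_irr.
  split=> //; rewrite e_sym.
  have := fv; rewrite A_eq => -[|//].
  (* Membership in [before] contradicts minimality, or at [b] gives [v = b]; so [v] is a neighbor of
     [f v]. *)
  case: (pselect (f v = b)) => [fb|fNb]; last first.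
    case/(earlier _ fNb) => y /andP[yf /eqP yNf] /fmin fy.
    by case: yNf; apply: anti.
  rewrite /before fb; case: asboolP => [_ /= /vb //|[]]; exact: b_least.
- by apply: (fP v).2; apply: A_nbr; rewrite e_sym.
- have [//|vu] := orP (well_order_total R_wo (f u) (f v)).
  (* [A (f v)] is an initial segment of [A (f u)] containing [v], hence also the earlier [u]. *)
  apply: (fP u).2; have [_] := A_init _ _ vu.
  by apply; [exact: (fP v).1|exact: (fP u).1|].
Qed.

(** * Fathers as dominating vertices in the square *)

Theorem theorem5p2 (V : eqType) (e : rel V)
    (e_sym : symmetric e) (e_irr : irreflexive e)
    (e_conn : connected_graph e) (e_cliques : finite_cliques e)
    (e_convex : convex_balls e)
    (R : rel V) (R_BFS : BFS_order R e) :
  dismantling_order R (square e).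
Proof.
have R_wo := R_BFS.1; split=> // v v_least.
have [b _ bmin] := well_order_min R_wo (A := setT) (x := v) I.
have b_least : least R b by move=> y; exact: bmin.
have vb : v <> b by move=> vb; apply: v_least; rewrite vb.
have [f [f_root f_lt f_min f_mono]] := BFS_father e_sym e_irr R_BFS b_least.
have f_adj w : w <> b -> e w (f w) by case/f_lt.
have [vf /andP[fv fNv]] := f_lt v vb.
have dom u : R u v -> dist e u v <= 2 -> dist e u (f v) <= 2.
  exact: (father_dominates e_sym e_conn e_convex (well_order_anti R_wo)
    (well_order_trans R_wo) (well_order_total R_wo) b_least f_root f_adj f_min
    f_mono e_irr vb).
have square_ball x y : dist e y x <= 2 -> x = y \/ square e x y.
  rewrite /square /= (dist_sym e_sym e_conn x) => ->; rewrite andbT.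
  case: (posnP (dist e y x)) => [/(dist_eq0 e_conn)->|]; by [left|right].
exists (f v); split.
- have /square_ball[vfE|//] : dist e (f v) v <= 2.
    by rewrite (dist_sym e_sym e_conn); have := dist_adj vf; lia.
  by rewrite -vfE e_irr in vf.
- by rewrite /strict /= fv.
have vS : v \in [set u | R u v] by rewrite inE; apply: well_order_refl.
have fS : f v \in [set u | R u v] by rewrite inE.
exists (exist _ v vS), (exist _ (f v) fS); split=> // -[u uS].
(* Unit balls in the induced square amount to distance at most 2 in [e], so [dom] applies. *)
move=> /ball1E uv; apply/ball1E.
have Ruv : R u v by have := uS; rewrite inE.
have uv2 : dist e u v <= 2.
  case: uv => [[->]|]; first by rewrite distxx.
  by rewrite /induced /= /square /= (dist_sym e_sym e_conn) => /andP[].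
have [fvu|] := square_ball (f v) u (dom u Ruv uv2); [left|by right].
exact/val_inj.
Qed.
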